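(* Let $\mathbf P_0,\mathbf P_1\in\mathbb C$, $\Delta\mathbf P_0=\mathbf P_1-\mathbf P_0$, let $\mathbf t_0,\mathbf t_1\in\mathbb C$ with $|\mathbf t_0|=|\mathbf t_1|=1$, and let $\kappa_0,\kappa_1\in\mathbb R$. Consider the planar PH biarc of degree $7$ interpolating these $G^2$ data with parameters $\alpha_0,\alpha_1,\beta_0,\beta_1$, taken with $\beta_0=\beta_1=0$, and let $e(\alpha_0,\alpha_1,\beta_0,\beta_1)$ be the associated length-interpolation function for the prescribed length $L$ (both defined in the context). Then for any $L>|\Delta\mathbf P_0|$ and any positive $\lambda\in\mathbb R$: (1) there exists at least one positive $\alpha_0^{(1)}\in\mathbb R$ such that $$e(\alpha_0^{(1)},\lambda\alpha_0^{(1)},0,0)=0\quad\text{and}\quad e(-\alpha_0^{(1)},-\lambda\alpha_0^{(1)},0,0)=0;$$ (2) there exists at least one positive $\alpha_0^{(2)}\in\mathbb R$ such that $$e(\alpha_0^{(2)},-\lambda\alpha_0^{(2)},0,0)=0\quad\text{and}\quad e(-\alpha_0^{(2)},\lambda\alpha_0^{(2)},0,0)=0.$$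
   Context: The plane $\mathbb R^2$ is identified with $\mathbb C$; $\mathrm i$ is the imaginary unit, $\overline{\mathbf z}$ is the complex conjugate, and $\mathbf n_\ell=\mathrm i\,\mathbf t_\ell$ for $\ell=0,1$. $B_i^n(t)=\binom{n}{i}(1-t)^{n-i}t^i$. For $\mathbf c=c_1+\mathrm i\,c_2\in\mathbb C$, $\boldsymbol\chi(\mathbf c)$ denotes the square root of $\mathbf c$ given by $\boldsymbol\chi(\mathbf c)=\frac{\sqrt2}{2}\big(\sqrt{|\mathbf c|+c_1}+\mathrm i\,\frac{c_2}{\sqrt{|\mathbf c|+c_1}}\big)$ when $|\mathbf c|+c_1\neq0$, and $\boldsymbol\chi(\mathbf c)=\mathrm i\sqrt{|\mathbf c|}$ when $\mathbf c$ is real and $\le 0$. For real $\alpha_0,\alpha_1\ne0$ and $\beta_0,\beta_1\in\mathbb R$ define $$\mathbf w_{A,0}=\alpha_0\,\boldsymbol\chi(\mathbf t_0),\qquad \mathbf w_{B,3}=\alpha_1\,\boldsymbol\chi(\mathbf t_1),$$ $$\mathbf w_{A,1}=\frac{1}{\mathbf w_{A,0}}\Big(\big(\alpha_0^2+\tfrac{\beta_0}{12}\big)\mathbf t_0+\kappa_0\tfrac{\alpha_0^4}{12}\mathbf n_0\Big),\qquad \mathbf w_{B,2}=\frac{1}{\mathbf w_{B,3}}\Big(\big(\alpha_1^2-\tfrac{\beta_1}{12}\big)\mathbf t_1-\kappa_1\tfrac{\alpha_1^4}{12}\mathbf n_1\Big),$$ $$52\,\mathbf U=5(\mathbf w_{A,0}+\mathbf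 w_{B,3})+39(\mathbf w_{A,1}+\mathbf w_{B,2}),$$ $$52\,\mathbf V=40(\mathbf w_{A,0}^2+\mathbf w_{B,3}^2)+49(\mathbf w_{A,0}\mathbf w_{A,1}+\mathbf w_{B,2}\mathbf w_{B,3})+62(\mathbf w_{A,1}^2+\mathbf w_{B,2}^2)+\mathbf w_{A,0}\mathbf w_{B,2}+\mathbf w_{A,1}\mathbf w_{B,3}+28\,\mathbf w_{A,1}\mathbf w_{B,2}-560\,\Delta\mathbf P_0,$$ $$52\,v=40|\mathbf w_{A,0}|^2+40|\mathbf w_{B,3}|^2+62|\mathbf w_{A,1}|^2+62|\mathbf w_{B,2}|^2+\mathrm{Re}\big(49\,\mathbf w_{A,0}\overline{\mathbf w_{A,1}}+49\,\mathbf w_{B,2}\overline{\mathbf w_{B,3}}+28\,\mathbf w_{A,1}\overline{\mathbf w_{B,2}}+\mathbf w_{A,0}\overline{\mathbf w_{B,2}}+\mathbf w_{A,1}\overline{\mathbf w_{B,3}}\big)-560\,L.$$ The length-interpolation function is $$e(\alpha_0,\alpha_1,\beta_0,\beta_1)=|\mathbf U^2-\mathbf V|-|\mathbf U|^2+v,$$ which depends only on the data $\mathbf P_\ell,\mathbf t_\ell,\kappa_\ell,L$ and on $\alpha_0,\alpha_1,\beta_0,\beta_1$. The interpolating PH biarc is the following curve. For a sign $\zeta_{\mathbf d}\in\{-1,1\}$ put $\mathbf d=\zeta_{\mathbf d}\boldsymbol\chi(\mathbf U^2-\mathbf V)-\mathbf U$, $\mathbf w_{A,2}=\frac12(\mathbf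 w_{A,1}+\mathbf d)$, $\mathbf w_{B,1}=\frac12(\mathbf w_{B,2}+\mathbf d)$, $\mathbf w_{A,3}=\mathbf w_{B,0}=\frac14\mathbf w_{A,1}+\frac12\mathbf d+\frac14\mathbf w_{B,2}$. Let $\mathbf r$ equal $\mathbf r_A$ on $[0,\frac12)$ and $\mathbf r_B$ on $[\frac12,1]$, where $\mathbf r_A'(t)=\big(\sum_{i=0}^3\mathbf w_{A,i}B_i^3(2t)\big)^2$, $\mathbf r_A(0)=\mathbf P_0$, $\mathbf r_B'(t)=\big(\sum_{i=0}^3\mathbf w_{B,i}B_i^3(2t-1)\big)^2$, $\mathbf r_B(1)=\mathbf P_1$. This curve interpolates the end points $\mathbf P_\ell$, unit tangents $\mathbf t_\ell$ and signed curvatures $\kappa_\ell$ at the parameters $\ell=0,1$. The condition that its arc length equals $L$ is the equation $e(\alpha_0,\alpha_1,\beta_0,\beta_1)=0$. *)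

(* Defs.v *)
From Stdlib Require Import Reals.
From Coquelicot Require Import Coquelicot.
Local Open Scope C_scope.

(** The plane is Coquelicot's [C]; numerals in [C_scope] are embedded reals. *)

(** Since [Cmod c + Re c = 0] exactly when [c] is real and nonpositive, the
    first branch is the case of the cut. *)
Definition chi (c : C) : C :=
  if Req_dec_T (Cmod c + Re c) 0
  then Ci * sqrt (Cmod c)
  else (sqrt 2 / 2)%R *
       (sqrt (Cmod c + Re c) + Ci * (Im c / sqrt (Cmod c + Re c))%R).

(** [w_A0 t0 a0] and [w_B3 t1 a1] are meant for nonzero [a0], [a1]; so are
    [w_A1] and [w_B2], which divide by them. *)
Definition w_A0 (t0 : C) (a0 : R) : C := a0 * chi t0.
Definition w_B3 (t1 : C) (a1 : R) : C := a1 * chi t1.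

(** The unit normal at an end point is [Ci * t]. *)
Definition w_A1 (t0 : C) (k0 a0 b0 : R) : C :=
  1 / w_A0 t0 a0 *
  ((a0 ^ 2 + b0 / 12)%R * t0 + (k0 * (a0 ^ 4 / 12))%R * (Ci * t0)).

Definition w_B2 (t1 : C) (k1 a1 b1 : R) : C :=
  1 / w_B3 t1 a1 *
  ((a1 ^ 2 - b1 / 12)%R * t1 - (k1 * (a1 ^ 4 / 12))%R * (Ci * t1)).

(** The free coefficient [d] of the biarc (whose two preimages are cubic with
    end coefficients [wA0], [wA1] and [wB2], [wB3], joined C^2) solves
    [d ^ 2 + 2 * U * d + V = 0], which is the end point condition, and the
    length condition reads [Cmod (d + U) ^ 2 - Cmod U ^ 2 + v = 0]; these are
    both scaled by [560 / 52]. *)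
Definition U_of (wA0 wA1 wB2 wB3 : C) : C :=
  (5 * (wA0 + wB3) + 39 * (wA1 + wB2)) / 52.

Definition V_of (wA0 wA1 wB2 wB3 dP : C) : C :=
  (40 * (wA0 ^ 2 + wB3 ^ 2) + 49 * (wA0 * wA1 + wB2 * wB3)
   + 62 * (wA1 ^ 2 + wB2 ^ 2) + wA0 * wB2 + wA1 * wB3 + 28 * (wA1 * wB2)
   - 560 * dP) / 52.

Definition v_of (wA0 wA1 wB2 wB3 : C) (L : R) : R :=
  ((40 * Cmod wA0 ^ 2 + 40 * Cmod wB3 ^ 2
    + 62 * Cmod wA1 ^ 2 + 62 * Cmod wB2 ^ 2
    + Re (49 * (wA0 * Cconj wA1) + 49 * (wB2 * Cconj wB3)
          + 28 * (wA1 * Cconj wB2) + wA0 * Cconj wB2 + wA1 * Cconj wB3)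
    - 560 * L) / 52)%R.

(** For nonzero [a0], [a1], the planar PH biarc of degree 7 with end points
    [P0], [P1], unit end tangents [t0], [t1], end curvatures [k0], [k1] and
    parameters [a0], [a1], [b0], [b1] has arc length [L] if and only if
    [length_interp P0 P1 t0 t1 k0 k1 L a0 a1 b0 b1 = 0]. *)
Definition length_interp (P0 P1 t0 t1 : C) (k0 k1 L : R)
    (a0 a1 b0 b1 : R) : R :=
  let wA0 := w_A0 t0 a0 in
  let wA1 := w_A1 t0 k0 a0 b0 in
  let wB2 := w_B2 t1 k1 a1 b1 in
  let wB3 := w_B3 t1 a1 in
  let U := U_of wA0 wA1 wB2 wB3 in
  let V := V_of wA0 wA1 wB2 wB3 (P1 - P0) in
  let v := v_of wA0 wA1 wB2 wB3 L in
  (Cmod (U ^ 2 - V) - Cmod U ^ 2 + v)%R.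

(* Main.v *)
Require Import Defs.
From Stdlib Require Import Reals Lra.
From Coquelicot Require Import Coquelicot.
Local Open Scope R_scope.

(** Write [w0, w1, w2, w3] for [w_A0], [w_A1], [w_B2], [w_B3].  The length
    function is [Cmod (U ^ 2 - V) + (v - Cmod U ^ 2)].  Up to a positive
    factor and the term linear in [L], the second summand is the Hermitian form which remains of the arc
    length (the integral of the squared modulus of the preimage) once it is
    minimised over the free coefficient [d]; it is therefore positive
    definite in [w0, w1, w2, w3], and explicitly (lemma [coef_length_ge])
    bounded below by a multiple of [Cmod w0 ^ 2].

    With [b0 = b1 = 0] the singular-looking quotients in [w_A1] and [w_B2]
    cancel, because [chi t] is a square root of [t]: along the line
    [a1 = mu * a0] all four coefficients are odd polynomials in [a0].  Hence
    the length function extends to an even continuous function of [a0] on the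
    whole line.  At [0] its value is [560 / 52 * (Cmod (P1 - P0) - L) < 0].
    Since [Cmod w0 = a0], the form above outweighs the term in [L] as soon as
    [a0 ^ 2 = 26 * L], whatever the curvatures and [mu] are.  The intermediate
    value theorem gives a positive root, evenness gives the opposite one, and
    the two parts of the theorem are [mu = lambda] and [mu = - lambda]. *)

(** * The square root *)

Lemma Cmod_sqr (z : C) : Cmod z ^ 2 = Re z ^ 2 + Im z ^ 2.
Proof.
  unfold Cmod; rewrite pow2_sqrt; [reflexivity|].
  apply Rplus_le_le_0_compat; apply pow2_ge_0.
Qed.

Lemma chi_sqr (c : C) : (chi c * chi c = c)%C.
Proof.
  pose proof (Cmod_sqr c) as Hm.
  pose proof (Cmod_ge_0 c) as H0.
  unfold chi; destruct (Req_dec_T (Cmod c + Re c) 0) as [H|H].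
  - assert (Hi : Im c = 0) by nra.
    pose proof (sqrt_sqrt _ H0) as Hs.
    destruct c as [x y]; unfold Re, Im in *; simpl in *.
    apply injective_projections; simpl; nra.
  - assert (Hp : 0 < Cmod c + Re c) by nra.
    pose proof (sqrt_sqrt _ (Rlt_le _ _ Hp)) as Hs.
    pose proof (sqrt_lt_R0 _ Hp) as Hsp.
    pose proof (sqrt_sqrt 2 ltac:(lra)) as H2.
    set (s := sqrt (Cmod c + Re c)) in *.
    set (q := sqrt 2) in *.
    destruct c as [x y]; unfold Re, Im in *; simpl in *.
    set (m := Cmod (x, y)) in *.
    assert (Hm2 : m = s * s - x) by lra.
    assert (Hy : y * y = s * s * (s * s - 2 * x)) by (rewrite Hm2 in Hm; nra).
    apply injective_projections; simpl.
    + transitivity ((q * q) / 4 * (s * s - (y * y) / (s * s))); [field; lra|].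
      rewrite H2, Hy; field; lra.
    + transitivity ((q * q) / 2 * y); [field; lra|].
      rewrite H2; field.
Qed.

Lemma Cmod_chi (c : C) : Cmod c = 1 -> Cmod (chi c) = 1.
Proof.
  intros H; pose proof (Cmod_ge_0 (chi c)) as H0.
  assert (H1 : Cmod (chi c) * Cmod (chi c) = 1)
    by (rewrite <- Cmod_mult, chi_sqr; exact H).
  nra.
Qed.

(** * The length function of the coefficients *)

Definition coef_length (w0 w1 w2 w3 dP : C) (L : R) : R :=
  Cmod (U_of w0 w1 w2 w3 ^ 2 - V_of w0 w1 w2 w3 dP)%C
  - Cmod (U_of w0 w1 w2 w3) ^ 2 + v_of w0 w1 w2 w3 L.

(** Every monomial of the length function has even degree in the
    coefficients. *)
Lemma coef_length_opp (w0 w1 w2 w3 dP : C) (L : R) :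
  coef_length (- w0)%C (- w1)%C (- w2)%C (- w3)%C dP L =
  coef_length w0 w1 w2 w3 dP L.
Proof.
  assert (HU : U_of (- w0)%C (- w1)%C (- w2)%C (- w3)%C = (- U_of w0 w1 w2 w3)%C)
    by (unfold U_of, Cdiv; ring).
  assert (HV : V_of (- w0)%C (- w1)%C (- w2)%C (- w3)%C dP = V_of w0 w1 w2 w3 dP)
    by (unfold V_of, Cdiv; ring).
  assert (Hv : v_of (- w0)%C (- w1)%C (- w2)%C (- w3)%C L = v_of w0 w1 w2 w3 L).
  { unfold v_of; rewrite !Cmod_opp.
    destruct w0, w1, w2, w3; simpl; field. }
  unfold coef_length; rewrite HU, HV, Hv, Cmod_opp.
  now replace ((- U_of w0 w1 w2 w3) ^ 2)%C with (U_of w0 w1 w2 w3 ^ 2)%C by ring.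
Qed.

Lemma coef_length_0 (dP : C) (L : R) :
  coef_length 0%C 0%C 0%C 0%C dP L = 560 / 52 * (Cmod dP - L).
Proof.
  assert (HU : U_of 0%C 0%C 0%C 0%C = 0%C) by (unfold U_of, Cdiv; ring).
  assert (HV : (0 ^ 2 - V_of 0 0 0 0 dP)%C = ((560 / 52)%R * dP)%C)
    by (rewrite RtoC_div by lra; unfold V_of, Cdiv; ring).
  unfold coef_length; rewrite HU, HV, Cmod_mult, Cmod_R, Rabs_pos_eq, Cmod_0 by lra.
  unfold v_of; rewrite Cmod_0; simpl; field.
Qed.

(** Real and imaginary parts contribute separately, each through the same real
    quadratic form.  That form is invariant under reversing the order of the
    coefficients, so it splits along the sums and differences of coefficients
    that correspond.  Completing the square in each part leaves
    [560 * (x0 + x3) ^ 2] and [728 * (x0 - x3) ^ 2], from which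
    [560 * ((x0 + x3) ^ 2 + (x0 - x3) ^ 2) = 1120 * (x0 ^ 2 + x3 ^ 2)] is taken
    out; [q] is what remains once [1120 * x0 ^ 2] is moved to the other side. *)
Lemma coef_length_ge (w0 w1 w2 w3 dP : C) (L : R) :
  1120 / 2704 * Cmod w0 ^ 2 - 560 / 52 * L <= coef_length w0 w1 w2 w3 dP L.
Proof.
  unfold coef_length.
  match goal with |- _ <= Cmod ?z - _ + _ => pose proof (Cmod_ge_0 z) as H end.
  enough (1120 / 2704 * Cmod w0 ^ 2 - 560 / 52 * L <=
          v_of w0 w1 w2 w3 L - Cmod (U_of w0 w1 w2 w3) ^ 2) by lra.
  clear H; unfold v_of; rewrite !Cmod_sqr.
  destruct w0 as [x0 y0], w1 as [x1 y1], w2 as [x2 y2], w3 as [x3 y3].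
  unfold U_of; simpl.
  set (q := fun x0 x1 x2 x3 : R =>
    455 * (x0 + x3 + x1 + x2) ^ 2
    + 1248 * (x1 - x2 + (x0 - x3) / 2) ^ 2
    + 168 * (x0 - x3) ^ 2 + 1120 * x3 ^ 2).
  assert (Hq : forall x0 x1 x2 x3, 0 <= q x0 x1 x2 x3).
  { intros; unfold q.
    repeat apply Rplus_le_le_0_compat; apply Rmult_le_pos;
      try apply pow2_ge_0; lra. }
  pose proof (Hq x0 x1 x2 x3) as Hx; pose proof (Hq y0 y1 y2 y3) as Hy.
  match goal with |- ?l <= ?r =>
    enough (r - l = (q x0 x1 x2 x3 + q y0 y1 y2 y3) / 2704) by lra end.
  unfold q; field.
Qed.

(** * Continuity *)

Definition Ccontinuity (f : R -> C) : Prop :=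
  continuity (fun x => Re (f x)) /\ continuity (fun x => Im (f x)).

Lemma Ccontinuity_const (c : C) : Ccontinuity (fun _ => c).
Proof. split; apply continuity_const; intros x y; reflexivity. Qed.

Lemma Ccontinuity_RtoC (f : R -> R) :
  continuity f -> Ccontinuity (fun x => RtoC (f x)).
Proof.
  intros Hf; split; [exact Hf|].
  apply continuity_const; intros x y; reflexivity.
Qed.

Lemma Ccontinuity_plus (f g : R -> C) :
  Ccontinuity f -> Ccontinuity g -> Ccontinuity (fun x => f x + g x)%C.
Proof.
  intros [f1 f2] [g1 g2]; split.
  - exact (continuity_plus _ _ f1 g1).
  - exact (continuity_plus _ _ f2 g2).
Qed.

Lemma Ccontinuity_opp (f : R -> C) :
  Ccontinuity f -> Ccontinuity (fun x => - f x)%C.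
Proof.
  intros [f1 f2]; split.
  - exact (continuity_opp _ f1).
  - exact (continuity_opp _ f2).
Qed.

Lemma Ccontinuity_conj (f : R -> C) :
  Ccontinuity f -> Ccontinuity (fun x => Cconj (f x)).
Proof.
  intros [f1 f2]; split; [exact f1|].
  exact (continuity_opp _ f2).
Qed.

Lemma Ccontinuity_mult (f g : R -> C) :
  Ccontinuity f -> Ccontinuity g -> Ccontinuity (fun x => f x * g x)%C.
Proof.
  intros [f1 f2] [g1 g2]; split.
  - exact (continuity_minus _ _ (continuity_mult _ _ f1 g1)
             (continuity_mult _ _ f2 g2)).
  - exact (continuity_plus _ _ (continuity_mult _ _ f1 g2)
             (continuity_mult _ _ f2 g1)).
Qed.

Lemma Ccontinuity_sqr (f : R -> C) :
  Ccontinuity f -> Ccontinuity (fun x => f x ^ 2)%C.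
Proof.
  intros Hf; simpl.
  repeat apply Ccontinuity_mult; trivial; apply Ccontinuity_const.
Qed.

Lemma continuity_Cmod (f : R -> C) :
  Ccontinuity f -> continuity (fun x => Cmod (f x)).
Proof.
  intros [f1 f2] x.
  apply (continuity_pt_comp (fun x => Re (f x) ^ 2 + Im (f x) ^ 2) sqrt).
  - assert (H : continuity (fun x => Re (f x) * Re (f x) + Im (f x) * Im (f x)))
      by exact (continuity_plus _ _ (continuity_mult _ _ f1 f1)
                  (continuity_mult _ _ f2 f2)).
    apply continuity_pt_ext with (2 := H x); intros y; simpl; ring.
  - apply continuity_pt_sqrt.
    apply Rplus_le_le_0_compat; apply pow2_ge_0.
Qed.

Ltac ccont :=
  repeat first
    [ assumption
    | apply Ccontinuity_const
    | apply Ccontinuity_plus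
    | apply Ccontinuity_opp
    | apply Ccontinuity_conj
    | apply Ccontinuity_sqr
    | apply Ccontinuity_mult ].

Lemma coef_length_continuity (w0 w1 w2 w3 : R -> C) (dP : C) (L : R) :
  Ccontinuity w0 -> Ccontinuity w1 -> Ccontinuity w2 -> Ccontinuity w3 ->
  continuity (fun x => coef_length (w0 x) (w1 x) (w2 x) (w3 x) dP L).
Proof.
  intros H0 H1 H2 H3.
  assert (HU : Ccontinuity (fun x => U_of (w0 x) (w1 x) (w2 x) (w3 x)))
    by (unfold U_of, Cdiv; ccont).
  assert (HV : Ccontinuity (fun x => V_of (w0 x) (w1 x) (w2 x) (w3 x) dP))
    by (unfold V_of, Cdiv, Cminus; ccont).
  assert (HZ : Ccontinuity (fun x => U_of (w0 x) (w1 x) (w2 x) (w3 x) ^ 2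
                 - V_of (w0 x) (w1 x) (w2 x) (w3 x) dP)%C)
    by (unfold Cminus; ccont).
  assert (Hn : forall (c : R) f, Ccontinuity f ->
                 continuity (fun x => c * Cmod (f x) ^ 2)).
  { intros c f Hf; apply continuity_mult.
    - apply continuity_const; intros x y; reflexivity.
    - apply continuity_Cmod in Hf; simpl.
      repeat apply continuity_mult; trivial.
      apply continuity_const; intros x y; reflexivity. }
  unfold coef_length, v_of.
  apply continuity_plus; [apply continuity_minus|].
  - now apply continuity_Cmod.
  - intros x; apply continuity_pt_ext with (2 := Hn 1 _ HU x).
    intros y; ring.
  - apply continuity_mult;
      [apply continuity_minus|apply continuity_const; intros x y; reflexivity];
      [|apply continuity_const; intros x y; reflexivity].
    apply continuity_plus.
    + repeat apply continuity_plus; apply Hn; assumption.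
    + match goal with |- continuity (fun x => Re (@?f x)) =>
        assert (HR : Ccontinuity f) by ccont; exact (proj1 HR) end.
Qed.

(** * The biarc coefficients without second-order parameters *)

Lemma chi_unit_neq_0 (t : C) : Cmod t = 1 -> chi t <> 0%C.
Proof.
  intros ht H; apply Cmod_chi in ht.
  rewrite H, Cmod_0 in ht; lra.
Qed.

Lemma w_A1_0 (t : C) (k a : R) : Cmod t = 1 -> a <> 0 ->
  w_A1 t k a 0 = (a * chi t * (1 + Ci * (k * a ^ 2 / 12)%R))%C.
Proof.
  intros ht ha; unfold w_A1, w_A0.
  pose proof (chi_unit_neq_0 t ht) as hc.
  assert (ha' : RtoC a <> 0%C) by (intros E; apply ha, RtoC_inj, E).
  pose proof (chi_sqr t) as E; set (c := chi t) in *; rewrite <- E.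
  replace (a ^ 2 + 0 / 12) with (a * a) by field.
  replace (k * (a ^ 4 / 12)) with (a * a * (k * a ^ 2 / 12)) by field.
  rewrite !RtoC_mult; set (z := RtoC (k * a ^ 2 / 12)).
  field; auto.
Qed.

Lemma w_B2_0 (t : C) (k a : R) : Cmod t = 1 -> a <> 0 ->
  w_B2 t k a 0 = (a * chi t * (1 - Ci * (k * a ^ 2 / 12)%R))%C.
Proof.
  intros ht ha; unfold w_B2, w_B3.
  pose proof (chi_unit_neq_0 t ht) as hc.
  assert (ha' : RtoC a <> 0%C) by (intros E; apply ha, RtoC_inj, E).
  pose proof (chi_sqr t) as E; set (c := chi t) in *; rewrite <- E.
  replace (a ^ 2 - 0 / 12) with (a * a) by field.
  replace (k * (a ^ 4 / 12)) with (a * a * (k * a ^ 2 / 12)) by field.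
  rewrite !RtoC_mult; set (z := RtoC (k * a ^ 2 / 12)).
  field; auto.
Qed.

(** The continuous extension across [a = 0] of the length function on the line
    [a1 = mu * a0]. *)
Definition line_length (dP t0 t1 : C) (k0 k1 L mu a : R) : R :=
  coef_length
    (a * chi t0)%C
    (a * chi t0 * (1 + Ci * (k0 * a ^ 2 / 12)%R))%C
    ((mu * a)%R * chi t1 * (1 - Ci * (k1 * (mu * a) ^ 2 / 12)%R))%C
    ((mu * a)%R * chi t1)%C
    dP L.

Lemma length_interp_line (P0 P1 t0 t1 : C) (k0 k1 L mu a : R) :
  Cmod t0 = 1 -> Cmod t1 = 1 -> mu <> 0 -> a <> 0 ->
  length_interp P0 P1 t0 t1 k0 k1 L a (mu * a) 0 0 =
  line_length (P1 - P0)%C t0 t1 k0 k1 L mu a.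
Proof.
  intros ht0 ht1 hmu ha.
  pose proof (Rmult_integral_contrapositive_currified _ _ hmu ha) as hb.
  unfold length_interp, line_length, coef_length; cbv zeta.
  now rewrite (w_A1_0 t0 k0 a ht0 ha), (w_B2_0 t1 k1 (mu * a) ht1 hb).
Qed.

Lemma line_length_even (dP t0 t1 : C) (k0 k1 L mu a : R) :
  line_length dP t0 t1 k0 k1 L mu (- a) = line_length dP t0 t1 k0 k1 L mu a.
Proof.
  unfold line_length.
  replace (mu * - a) with (- (mu * a)) by ring.
  replace ((- a) ^ 2) with (a ^ 2) by ring.
  replace ((- (mu * a)) ^ 2) with ((mu * a) ^ 2) by ring.
  rewrite !RtoC_opp.
  rewrite <- (coef_length_opp (a * chi t0)%C).
  f_equal; ring.
Qed.

Lemma line_length_continuity (dP t0 t1 : C) (k0 k1 L mu : R) :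
  continuity (line_length dP t0 t1 k0 k1 L mu).
Proof.
  assert (Ha : Ccontinuity (fun a => RtoC a)).
  { apply Ccontinuity_RtoC, derivable_continuous, derivable_id. }
  assert (Hb : Ccontinuity (fun a => RtoC (mu * a))).
  { apply Ccontinuity_RtoC; reg. }
  assert (Hk0 : Ccontinuity (fun a => RtoC (k0 * a ^ 2 / 12))).
  { apply Ccontinuity_RtoC; reg. }
  assert (Hk1 : Ccontinuity (fun a => RtoC (k1 * (mu * a) ^ 2 / 12))).
  { apply Ccontinuity_RtoC; reg. }
  unfold line_length, Cminus; apply coef_length_continuity; ccont.
Qed.

(** On each line through the origin there is a root at distance at most
    [sqrt (26 * L)], the point where the lower bound [coef_length_ge] becomes
    zero. *)
Lemma length_interp_line_root (P0 P1 t0 t1 : C) (k0 k1 L mu : R) :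
  Cmod t0 = 1 -> Cmod t1 = 1 -> Cmod (P1 - P0)%C < L -> mu <> 0 ->
  exists a : R, 0 < a /\
    length_interp P0 P1 t0 t1 k0 k1 L a (mu * a) 0 0 = 0 /\
    length_interp P0 P1 t0 t1 k0 k1 L (- a) (mu * - a) 0 0 = 0.
Proof.
  intros ht0 ht1 hL hmu.
  set (g := line_length (P1 - P0)%C t0 t1 k0 k1 L mu).
  assert (HL : 0 < 26 * L) by (pose proof (Cmod_ge_0 (P1 - P0)%C); lra).
  assert (Hg0 : g 0 < 0).
  { replace (g 0) with (coef_length 0%C 0%C 0%C 0%C (P1 - P0)%C L).
    - rewrite coef_length_0; lra.
    - unfold g, line_length; rewrite Rmult_0_r; f_equal; ring. }
  set (M := sqrt (26 * L)).
  assert (HM : 0 < M) by (apply sqrt_lt_R0, HL).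
  assert (HgM : 0 <= g M).
  { eapply Rle_trans; [|apply coef_length_ge].
    rewrite Cmod_mult, Cmod_R, Cmod_chi, Rmult_1_r, pow2_abs by exact ht0.
    unfold M; rewrite pow2_sqrt; lra. }
  destruct (IVT_cor g 0 M) as [a [[Ha _] Hga]].
  - apply line_length_continuity.
  - lra.
  - nra.
  - assert (Ha0 : a <> 0) by (intros E; rewrite E in Hga; lra).
    exists a; repeat split.
    + lra.
    + rewrite length_interp_line; assumption.
    + rewrite length_interp_line by (trivial; lra).
      rewrite line_length_even; exact Hga.
Qed.

Theorem theorem2 (P0 P1 t0 t1 : C) (k0 k1 : R)
    (ht0 : Cmod t0 = 1) (ht1 : Cmod t1 = 1)
    (L : R) (hL : Cmod (P1 - P0)%C < L) (lambda : R) (hlambda : 0 < lambda) :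
  (exists a : R, 0 < a /\
     length_interp P0 P1 t0 t1 k0 k1 L a (lambda * a) 0 0 = 0 /\
     length_interp P0 P1 t0 t1 k0 k1 L (- a) (- lambda * a) 0 0 = 0) /\
  (exists a : R, 0 < a /\
     length_interp P0 P1 t0 t1 k0 k1 L a (- lambda * a) 0 0 = 0 /\
     length_interp P0 P1 t0 t1 k0 k1 L (- a) (lambda * a) 0 0 = 0).
Proof.
  split.
  - destruct (length_interp_line_root P0 P1 t0 t1 k0 k1 L lambda)
      as [a [Ha [H1 H2]]]; trivial; [lra|].
    exists a; replace (- lambda * a) with (lambda * - a) by ring; auto.
  - destruct (length_interp_line_root P0 P1 t0 t1 k0 k1 L (- lambda))
      as [a [Ha [H1 H2]]]; trivial; [lra|].
    exists a; replace (lambda * a) with (- lambda * - a) by ring; auto.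
Qed.
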